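(* Let $N\ge 4$, let $G=2^{N-1}$, and let $S$ be an integer with $0<S<G$. Then the number of filled cells in the emanation table of the $2^N$-ions with strut constant $S$ is a multiple of $24$.
   Context: $2^N$-ions. For $N\ge 0$ the $2^N$-ions are the real algebra with basis units $i_0,i_1,\dots,i_{2^N-1}$ produced by the Cayley-Dickson process, with the following sign convention. $i_0=1$; $i_a^2=-1$ for $a\neq 0$; for distinct nonzero $a,b$ one has $i_a i_b=-i_b i_a=\pm i_{a\oplus b}$, where $\oplus$ is bitwise XOR. Write ''$(a,b,c)$ is a trip'' (in cyclically positive order) if $a,b,c$ are distinct nonzero indices with $c=a\oplus b$ and $i_ai_b=+i_c$, $i_bi_c=+i_a$, $i_ci_a=+i_b$. Signs are determined recursively by: (Rule 0) a trip of the $2^k$-ions remains a trip in the $2^{k+1}$-ions; (Rule 1) if $\Gamma$ is a power of $2$ and $0<u<\Gamma$, then $(u,\Gamma,\Gamma+u)$ is a trip; (Rule 2) if $\Gamma$ is a power of $2$ and $(a,b,c)$ is a trip with $a,b,c<\Gamma$, then $(a,c+\Gamma,b+\Gamma)$ is a trip (this applies to each cyclic rotation of $(a,b,c)$). Assessors. Fix $N\ge 4$, the generator $G=2^{N-1}$, a strut constant $S$ with $0<S<G$, and put $X=G+S$. The L-indices are the $G-2$ integers $u$ with $0<u<G$, $u\neq S$. The Assessor with L-index $u$ is the plane spanned by $i_u$ and $i_{U}$, where $U=u\oplus X=G+(u\oplus S)$ is its U-index. The Assessors with L-indices $u$ and $u\oplus S$ are strut opposites. Two Assessors with L-indices $u,v$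 mutually zero-divide if there are signs $\sigma,\tau\in\{+1,-1\}$ with $(i_u+\sigma i_{u\oplus X})(i_v+\tau i_{v\oplus X})=0$. Emanation table. The emanation table for $(N,S)$ is the $(G-2)\times(G-2)$ array with rows and columns labeled by the L-indices. The cell with row label $r$ and column label $c$ is blank if $r=c$ or if $r\oplus c=S$ (the two long diagonals), and blank if the Assessors with L-indices $r$ and $c$ do not mutually zero-divide; otherwise the cell is filled, with entry $r\oplus c$. *)

(* Defs.v *)
From Stdlib Require Import PeanoNat.
From mathcomp Require Import all_boot all_order all_algebra.
From mathcomp Require Import boolp reals.
From mathcomp Require Import zify.

Set Implicit Arguments.
Unset Strict Implicit.
Unset Printing Implicit Defensive.

Import Order.TTheory GRing.Theory Num.Theory.
Local Open Scope ring_scope.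

Notation "a (+) b" := (Nat.lxor a b)
  (at level 50, left associativity) : nat_scope.

(* Positively oriented triples of indices of basis units. A trip of the
   2^k-ions remains one in the 2^(k+1)-ions, so a single relation on [nat] serves
   all the 2^N-ions at once; closure under [trip_rot] makes [trip_rule2] apply to
   every rotation of (a, b, c). *)
Inductive trip : nat -> nat -> nat -> Prop :=
| trip_rule1 (k u : nat) : (0 < u < 2 ^ k)%N -> trip u (2 ^ k)%N (2 ^ k + u)%N
| trip_rule2 (k a b c : nat) :
    (a < 2 ^ k)%N -> (b < 2 ^ k)%N -> (c < 2 ^ k)%N ->
    trip a b c -> trip a (c + 2 ^ k)%N (b + 2 ^ k)%N
| trip_rot (a b c : nat) : trip a b c -> trip b c a.

(* The sign in i_a i_b = +/- i_(a (+) b). That the last branch is i_b i_a with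
   the opposite sign is [trip_total] and [trip_asym] below. *)
Definition unit_sign (R : realType) (a b : nat) : R :=
  if (a == 0%N) || (b == 0%N) then 1
  else if a == b then -1
  else if `[< trip a b (a (+) b)%N >] then 1 else -1.

(* The 2^N-ions are the row vectors of coordinates in the basis
   i_0, ..., i_(2^N - 1), multiplied by bilinear extension of the table of the
   units. [ion_unit] has junk value 0 when [2 ^ N <= a]. *)
Definition ion_unit (R : realType) (N a : nat) : 'rV[R]_(2 ^ N) :=
  \row_(k < 2 ^ N) (k == a :> nat)%:R.

Definition ion_mul (R : realType) (N : nat) (x y : 'rV[R]_(2 ^ N)) :
    'rV[R]_(2 ^ N) :=
  \row_(k < 2 ^ N)
    \sum_(a < 2 ^ N) \sum_(b < 2 ^ N | (a (+) b)%N == k)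
      unit_sign R a b * x 0 a * y 0 b.

Definition generator (N : nat) : nat := (2 ^ N.-1)%N.

Definition Lindex (N S u : nat) : bool :=
  [&& (0 < u)%N, (u < generator N)%N & u != S].

Definition Uindex (N S u : nat) : nat := (u (+) (generator N + S))%N.

(* i_u + i_U for [s = false], i_u - i_U for [s = true]. *)
Definition diagonal (R : realType) (N S u : nat) (s : bool) : 'rV[R]_(2 ^ N) :=
  ion_unit R N u + (-1) ^+ s *: ion_unit R N (Uindex N S u).

Definition zero_divide (R : realType) (N S u v : nat) : bool :=
  [exists s : bool, exists t : bool,
     ion_mul (diagonal R N S u s) (diagonal R N S v t) == 0].

(* [None] is a blank cell. *)
Definition emanation (R : realType) (N S r c : nat) : option nat :=
  if [|| r == c, (r (+) c)%N == S | ~~ zero_divide R N S r c] then None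
  else Some (r (+) c)%N.

Definition filled_cells (R : realType) (N S : nat) :
    {set 'I_(generator N) * 'I_(generator N)} :=
  [set rc : 'I_(generator N) * 'I_(generator N)
   | [&& Lindex N S rc.1, Lindex N S rc.2
       & isSome (emanation R N S rc.1 rc.2)]].

Lemma lxor_lt k a b :
  (a < 2 ^ k)%N -> (b < 2 ^ k)%N -> (a (+) b < 2 ^ k)%N.
Proof.
have modK x : (x < 2 ^ k)%N <-> x = Nat.modulo x (Nat.pow 2 k).
  have -> : Nat.pow 2 k = (2 ^ k)%N by elim: k => //= k ->; rewrite expnS; lia.
  have p0 : (2 ^ k)%N <> 0%N by have := expn_gt0 2 k; lia.
  split=> [lt_x|->]; first by rewrite Nat.mod_small //; lia.
  by have := Nat.mod_upper_bound x _ p0; lia.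
move=> /modK a_k /modK b_k; apply/modK.
apply: Nat.bits_inj => i; case: (Nat.lt_ge_cases i k) => ik.
  by rewrite Nat.mod_pow2_bits_low.
rewrite Nat.mod_pow2_bits_high // Nat.lxor_spec a_k b_k.
by rewrite !Nat.mod_pow2_bits_high.
Qed.

Lemma lxor_pow2 k a : (a < 2 ^ k)%N -> (a (+) 2 ^ k = a + 2 ^ k)%N.
Proof.
move=> lt_a; rewrite -plusE Nat.add_nocarry_lxor //.
have pE : (2 ^ k)%N = Nat.pow 2 k by elim: (k) => //= j <-; rewrite expnS; lia.
apply: Nat.bits_inj => i; rewrite Nat.land_spec Nat.bits_0 pE Nat.pow2_bits_eqb.
case: Nat.eqb_spec => [<-|]; last by rewrite andbF.
rewrite andbT -(Nat.mod_small a (Nat.pow 2 k)); last by rewrite -pE; lia.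
by rewrite Nat.mod_pow2_bits_high.
Qed.

Lemma lxor_hil k a b : (a < 2 ^ k)%N -> (b < 2 ^ k)%N ->
  ((a + 2 ^ k) (+) b = (a (+) b) + 2 ^ k)%N.
Proof.
move=> lt_a lt_b; rewrite -!lxor_pow2 ?lxor_lt //.
by rewrite !Nat.lxor_assoc (Nat.lxor_comm b).
Qed.

Lemma lxor_hir k a b : (a < 2 ^ k)%N -> (b < 2 ^ k)%N ->
  (a (+) (b + 2 ^ k) = (a (+) b) + 2 ^ k)%N.
Proof.
by move=> ? ?; rewrite Nat.lxor_comm lxor_hil // (Nat.lxor_comm a).
Qed.

Lemma lxor_hilr k a b : (a < 2 ^ k)%N -> (b < 2 ^ k)%N ->
  ((a + 2 ^ k) (+) (b + 2 ^ k) = a (+) b)%N.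
Proof.
move=> lt_a lt_b; rewrite -!lxor_pow2 // Nat.lxor_assoc.
rewrite (Nat.lxor_comm b) -(Nat.lxor_assoc (2 ^ k)%N) Nat.lxor_nilpotent.
by rewrite Nat.lxor_0_l.
Qed.

Lemma trip_lxor a b c : trip a b c -> c = (a (+) b)%N.
Proof.
elim=> {a b c} [k u /andP[_ lt_u]|k a b c la lb lc _ cE|a b c _ ->].
- by rewrite lxor_pow2 // addnC.
- rewrite lxor_hir // cE -Nat.lxor_assoc Nat.lxor_nilpotent.
  by rewrite Nat.lxor_0_l.
- by rewrite (Nat.lxor_comm a) -Nat.lxor_assoc Nat.lxor_nilpotent Nat.lxor_0_l.
Qed.

(* Recursive form of the sign table of the units with index below [2 ^ k]. *)
Fixpoint tripb (k a b : nat) : bool :=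
  if k is j.+1 then
    let g := (2 ^ j)%N in
    match (a < g)%N, (b < g)%N with
    | true, true => tripb j a b
    | true, false => (b == g) || ((b - g != a)%N && tripb j (b - g)%N a)
    | false, true => ~~ ((a == g) || ((a - g != b)%N && tripb j (a - g)%N b))
    | false, false => (a == g) || ((b != g) && tripb j (b - g)%N (a - g)%N)
    end
  else false.

Lemma tripb_low k a b : (a < 2 ^ k)%N -> (b < 2 ^ k)%N ->
  tripb k.+1 a b = tripb k a b.
Proof. by move=> la lb; rewrite /= la lb. Qed.

Lemma tripbC k a b : (0 < a < 2 ^ k)%N -> (0 < b < 2 ^ k)%N -> a != b ->
  tripb k b a = ~~ tripb k a b.
Proof.
elim: k a b => [|k IH] a b; first by rewrite expn0; lia.
rewrite expnS /= => Ha Hb ab.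
case: (ltnP a (2 ^ k)) => la; case: (ltnP b (2 ^ k)) => lb; rewrite ?negbK //.
  by apply: IH; lia.
have [a0|a0] := eqVneq a (2 ^ k)%N; have [b0|b0] := eqVneq b (2 ^ k)%N => //=.
  by lia.
by apply: IH; lia.
Qed.

Lemma trip_bound a b c : trip a b c ->
  [/\ 0 < a, 0 < b & 0 < c]%N /\ [/\ a != b, b != c & c != a].
Proof.
elim=> {a b c} [k u H|k a b c la lb lc _ [[? ? ?] [? ? ?]]|a b c _ [[? ? ?] [? ? ?]]].
- by split; split; lia.
- by split; split; lia.
- by split; split.
Qed.

Lemma trip_tripb a b c : trip a b c -> forall k,
  (a < 2 ^ k)%N -> (b < 2 ^ k)%N -> (c < 2 ^ k)%N ->
  [/\ tripb k a b, tripb k b c & tripb k c a].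
Proof.
elim=> {a b c} [j u Hu|j a b c la lb lc T IH|a b c _ IH] k ha hb hc; last first.
- by have [] := IH k hc ha hb.
- have [[a0 b0 c0] [ab bc ca]] := trip_bound T.
  elim: k ha hb hc => [|k IHk]; first by rewrite expn0; lia.
  move=> ha hb hc; have [ltjk|ltkj|ejk] := ltngtP j k.
  + have : (2 ^ j.+1 <= 2 ^ k)%N by rewrite leq_exp2l.
    rewrite expnS => le.
    have [||| H1 H2 H3] := IHk; try lia.
    by split; rewrite tripb_low //; lia.
  + have : (2 ^ k.+1 <= 2 ^ j)%N by rewrite leq_exp2l.
    by lia.
  subst k; have [tab tbc tca] := IH j la lb lc.
  split=> /=.
  + rewrite la; case: ltnP; first lia.
    by rewrite addnK ca tca orbT.
  + do 2![case: ltnP; first lia] => _ _.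
    by rewrite !addnK tbc andbT; lia.
  + rewrite la; case: ltnP; first lia.
    have -> : tripb j (b + 2 ^ j - 2 ^ j)%N a = false; last by lia.
    by rewrite addnK tripbC ?tab //; lia.
elim: k ha hb hc => [|k IHk] ha hb hc; first by move: hb hc; rewrite expn0; lia.
have [ltjk|ltkj|ejk] := ltngtP j k.
- have : (2 ^ j.+1 <= 2 ^ k)%N by rewrite leq_exp2l.
  rewrite expnS => le.
  have [||| H1 H2 H3] := IHk; try lia.
  by split; rewrite tripb_low //; lia.
- have : (2 ^ k.+1 <= 2 ^ j)%N by rewrite leq_exp2l.
  by lia.
have [/andP[u0 lu] g_u] := (Hu, leq_addr u (2 ^ j)%N).
by subst k; split; rewrite /= ?lu !ltnNge ?leqnn ?g_u //=; lia.
Qed.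

Lemma trip_asym a b c : trip a b c -> ~ trip b a c.
Proof.
move=> T T'; have [[a0 b0 c0] [ab bc ca]] := trip_bound T.
pose k := (a + b + c)%N; have hk : (k < 2 ^ k)%N by rewrite ltn_expl.
have [||| t _ _] := trip_tripb T (k := k); try lia.
have [||| t' _ _] := trip_tripb T' (k := k); try lia.
by move: t'; rewrite tripbC ?t //; lia.
Qed.

Lemma trip_total a b : (0 < a)%N -> (0 < b)%N -> a != b ->
  trip a b (a (+) b)%N \/ trip b a (a (+) b)%N.
Proof.
move=> a0 b0 ab.
have [k [la lb]] : exists k, (a < 2 ^ k)%N /\ (b < 2 ^ k)%N.
  have hk : (a + b < 2 ^ (a + b))%N by rewrite ltn_expl.
  by exists (a + b)%N; lia.
elim: k a b a0 b0 ab la lb => [|k IH] a b; first by rewrite expn0; lia.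
have mixed x y : (0 < x < 2 ^ k)%N -> (y < 2 ^ k)%N ->
    trip x (y + 2 ^ k)%N (x (+) (y + 2 ^ k))%N
    \/ trip (y + 2 ^ k)%N x (x (+) (y + 2 ^ k))%N.
  move=> Hx Hy; rewrite lxor_hir //; last by lia.
  have [y0|y0] := eqVneq y 0%N.
    by subst y; left; rewrite Nat.lxor_0_r add0n addnC; apply: trip_rule1.
  have [xy|xy] := eqVneq x y.
    subst y; right; rewrite Nat.lxor_nilpotent add0n addnC.
    by do 2!apply: trip_rot; apply: trip_rule1.
  have lt_xy : (x (+) y < 2 ^ k)%N by apply: lxor_lt; lia.
  have [||||| T|T] := IH x y; try lia.
    by right; do 2!apply: trip_rot; apply: trip_rule2 => //; lia.
  by left; apply: trip_rule2; try lia; do 1!apply: trip_rot.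
rewrite expnS => a0 b0 ab la lb.
have [lta|lea] := ltnP a (2 ^ k); have [ltb|leb] := ltnP b (2 ^ k).
- exact: IH.
- by rewrite -(subnK leb); apply: mixed; lia.
- rewrite -(subnK lea) Nat.lxor_comm.
  by have [||H|H] := mixed b (a - 2 ^ k)%N; try lia; [right|left].
rewrite -(subnK lea) -(subnK leb).
set x := (a - _)%N; set y := (b - _)%N.
have [hx hy] : (x < 2 ^ k)%N /\ (y < 2 ^ k)%N by rewrite /x /y; lia.
have xy : x != y by rewrite /x /y; lia.
rewrite lxor_hilr //; have [x0|x0] := eqVneq x 0%N.
  rewrite x0 Nat.lxor_0_l add0n; left; apply: trip_rot; rewrite addnC.
  by apply: trip_rule1; lia.
have [y0|y0] := eqVneq y 0%N.
  rewrite y0 Nat.lxor_0_r add0n; right; apply: trip_rot; rewrite addnC.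
  by apply: trip_rule1; lia.
have lt_xy : (x (+) y < 2 ^ k)%N by apply: lxor_lt.
have [||||| T|T] := IH x y; try lia.
  right; apply: trip_rot; apply: trip_rule2 => //.
  by do 2!apply: trip_rot.
left; apply: trip_rot; apply: trip_rule2 => //.
by do 2!apply: trip_rot.
Qed.

Lemma unit_signN (R : realType) a b : (0 < a)%N -> (0 < b)%N -> a != b ->
  unit_sign R b a = - unit_sign R a b.
Proof.
move=> a0 b0 ab; rewrite /unit_sign (gtn_eqF a0) (gtn_eqF b0) /= eq_sym (negPf ab).
rewrite (Nat.lxor_comm b); have [T|T] := trip_total a0 b0 ab.
  rewrite (asboolT T) (asboolF (trip_asym T)) //.
by rewrite (asboolT T) (asboolF (trip_asym T)) opprK.
Qed.

Lemma ion_mul_unit (R : realType) N a b :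
  (a < 2 ^ N)%N -> (b < 2 ^ N)%N ->
  ion_mul (ion_unit R N a) (ion_unit R N b)
    = unit_sign R a b *: ion_unit R N (a (+) b)%N.
Proof.
move=> la lb; apply/rowP => k; rewrite !mxE.
rewrite (bigD1 (Ordinal la)) //= [X in _ + X]big1 => [|i ia]; last first.
  apply: big1 => j _; rewrite !mxE -val_eqE /= in ia *.
  by rewrite (negPf ia) mulr0 mul0r.
rewrite addr0 big_mkcond (bigD1 (Ordinal lb)) //= big1 => [|j jb]; last first.
  case: ifP => // _; move: jb; rewrite -val_eqE /= => jb.
  by rewrite !mxE (negPf jb) mulr0.
rewrite addr0 !mxE !eqxx !mulr1 eq_sym; case: eqP => _ /=.
  by rewrite mulr1.
by rewrite mulr0.
Qed.

(* Main.v *)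
(* Write sgn for the sign in i_a i_b = sgn(a,b) i_(a (+) b). The product of two
   diagonals has two coordinates, so u and v zero-divide iff
   sgn(u,v) sgn(U,V) sgn(u,V) sgn(U,v) = 1. Since U = G + u (+) S, Rule 2
   turns this into a parity condition on the four signs of the pairs in
   {u, u (+) S} x {v, v (+) S}. It is thus invariant under u -> u (+) S, under
   v -> v (+) S, under exchange of u and v (each sign changes, an even number of
   times) and, by cyclicity of trips, under (u, v) -> (v, u (+) v). When u, v and
   S are independent over F_2, the first three symmetries give a factor 8 and
   the last one, of order 3 and without fixed points, a factor 3. *)
Require Import Defs.
From Stdlib Require Import PeanoNat.
From mathcomp Require Import all_boot all_order all_algebra.
From mathcomp Require Import boolp reals.
From mathcomp Require Import zify.

Set Implicit Arguments.
Unset Strict Implicit.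
Unset Printing Implicit Defensive.

Import GRing.Theory Num.Theory.
Local Open Scope ring_scope.

(** * Cancellation rules for bitwise XOR *)

Lemma lxorK (a b : nat) : (a (+) b (+) b)%N = a.
Proof. by rewrite Nat.lxor_assoc Nat.lxor_nilpotent Nat.lxor_0_r. Qed.

Lemma lxorKC (a b : nat) : (b (+) (a (+) b))%N = a.
Proof. by rewrite Nat.lxor_comm lxorK. Qed.

Lemma lxorAC (a b c : nat) : (a (+) b (+) c = a (+) c (+) b)%N.
Proof. by rewrite !Nat.lxor_assoc (Nat.lxor_comm b). Qed.

Lemma lxor_eq0 (a b : nat) : ((a (+) b)%N == 0%N) = (a == b).
Proof. by apply/eqP/eqP => /Nat.lxor_eq_0_iff. Qed.

Lemma lxor_eqr (a b : nat) : ((a (+) b)%N == b) = (a == 0%N).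
Proof. by rewrite -lxor_eq0 lxorK. Qed.

(** * Signs of products of units as truth values *)

Definition positive (a b : nat) : bool := `[< trip a b (a (+) b)%N >].

Lemma positiveC (a b : nat) : (0 < a)%N -> (0 < b)%N -> a != b ->
  positive b a = ~~ positive a b.
Proof.
move=> a0 b0 ab; rewrite /positive (Nat.lxor_comm b).
have [T|T] := trip_total a0 b0 ab;
  by rewrite (asboolT T) (asboolF (trip_asym T)).
Qed.

Lemma positive_rot (a b : nat) : positive b (a (+) b)%N = positive a b.
Proof.
rewrite /positive lxorKC; apply/asboolP/asboolP => T.
  by do 2!apply: trip_rot.
exact: trip_rot.
Qed.

(** Rule 2 exchanges the last two places of a trip while raising them by [2 ^ k], so raising one
    factor reverses the sign. *)
Lemma positive_hir (k a b : nat) : (0 < a < 2 ^ k)%N -> (0 < b < 2 ^ k)%N ->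
  a != b -> positive a (b + 2 ^ k)%N = ~~ positive a b.
Proof.
move=> /andP[a0 la] /andP[b0 lb] ab.
have lab := lxor_lt la lb.
have [T|T] := trip_total a0 b0 ab.
  have p : positive a b by apply/asboolP.
  have T2 := trip_rot (trip_rot (trip_rule2 la lb lab T)).
  have : positive (b + 2 ^ k)%N a.
    by apply/asboolP; rewrite lxor_hil // (Nat.lxor_comm b).
  by rewrite positiveC ?p; try lia; move/negPf.
(* Here the trip is [b], [a], [a (+) b]; one rotation brings [a] to the front, where Rule 2 keeps it
   unraised. *)
have -> : positive a b = false.
  by apply: asboolF => T'; exact: trip_asym T' T.
apply/asboolP; rewrite lxor_hir //; apply: trip_rule2 => //; exact: trip_rot.
Qed.

(** Rotation replaces the two raised factors by [b + 2 ^ k] and [a (+) b], only one of which is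
    raised, so [positive_hir] applies. *)
Lemma positive_hilr (k a b : nat) : (0 < a < 2 ^ k)%N -> (0 < b < 2 ^ k)%N ->
  a != b -> positive (a + 2 ^ k)%N (b + 2 ^ k)%N = ~~ positive a b.
Proof.
move=> a_k b_k ab; have [[a0 la] [b0 lb]] := (andP a_k, andP b_k).
have lab := lxor_lt la lb.
have ab0 : (0 < a (+) b)%N by rewrite lt0n lxor_eq0.
have abb : (a (+) b)%N != b by rewrite lxor_eqr -lt0n.
rewrite -positive_rot lxor_hilr // positiveC; try lia.
by rewrite positive_hir ?ab0 // negbK positiveC ?positive_rot // eq_sym.
Qed.

Lemma unit_sign_positive (R : realType) (a b : nat) :
  (0 < a)%N -> (0 < b)%N -> a != b ->
  unit_sign R a b = (-1) ^+ ~~ positive a b.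
Proof.
move=> a0 b0 ab; rewrite /unit_sign (gtn_eqF a0) (gtn_eqF b0) (negPf ab) /=.
by rewrite /positive; case: asboolP.
Qed.

(** * Bilinearity of the product and independence of units *)

Lemma ion_mulDl (R : realType) (N : nat) (c : R) (x y z : 'rV[R]_(2 ^ N)) :
  ion_mul (x + c *: y) z = ion_mul x z + c *: ion_mul y z.
Proof.
apply/rowP => k; rewrite !mxE mulr_sumr -big_split; apply: eq_bigr => a _ /=.
rewrite mulr_sumr -big_split; apply: eq_bigr => b _ /=.
by rewrite !mxE mulrDr mulrDl !mulrA (mulrC c).
Qed.

Lemma ion_mulDr (R : realType) (N : nat) (c : R) (x y z : 'rV[R]_(2 ^ N)) :
  ion_mul z (x + c *: y) = ion_mul z x + c *: ion_mul z y.
Proof.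
apply/rowP => k; rewrite !mxE mulr_sumr -big_split; apply: eq_bigr => a _ /=.
rewrite mulr_sumr -big_split; apply: eq_bigr => b _ /=.
by rewrite !mxE mulrDr !mulrA -!(mulrC c) !mulrA.
Qed.

Lemma ion_unit_free (R : realType) (N a b : nat) (x y : R) :
  (a < 2 ^ N)%N -> (b < 2 ^ N)%N -> a != b ->
  (x *: ion_unit R N a + y *: ion_unit R N b == 0) = (x == 0) && (y == 0).
Proof.
move=> la lb ab; apply/eqP/andP => [/rowP e|[/eqP-> /eqP->]]; last first.
  by rewrite !scale0r addr0.
have := e (Ordinal la); have := e (Ordinal lb).
rewrite !mxE /= !eqxx (negPf ab) eq_sym (negPf ab) !mulr0 !mulr1 add0r addr0.
by move=> -> ->.
Qed.

Lemma signrD_eq0 (R : realType) (b c : bool) :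
  ((-1) ^+ b + (-1) ^+ c == 0 :> R) = (b != c).
Proof.
have p : (1 + 1 != 0 :> R) by rewrite (pnatr_eq0 R 2).
by case: b c => [] [] /=; rewrite ?expr0 ?expr1 ?subrr ?addNr ?eqxx //
  ?(negPf p) // -opprD oppr_eq0 (negPf p).
Qed.

(** * The parity condition and its symmetries *)

Definition off (S a : nat) : bool := (a != 0%N) && (a != S).

Lemma off_lxorr (S a : nat) : off S (a (+) S)%N = off S a.
Proof. by rewrite /off lxor_eq0 lxor_eqr andbC. Qed.

(** For nonzero [S] this is linear independence of [u], [v], [S] over F_2: no nonzero combination of
    [u] and [v] lies in the span {0, [S]}. *)
Definition indep (S u v : nat) : bool := [&& off S u, off S v & off S (u (+) v)%N].

Lemma indepC (S u v : nat) : indep S v u = indep S u v.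
Proof. by rewrite /indep (Nat.lxor_comm v) andbCA. Qed.

Lemma indep_lxorl (S u v : nat) : indep S (u (+) S)%N v = indep S u v.
Proof. by rewrite /indep lxorAC !off_lxorr. Qed.

Lemma indep_rot (S u v : nat) : indep S v (u (+) v)%N = indep S u v.
Proof. by rewrite /indep lxorKC; do 3!case: off. Qed.

Lemma indep_gt0 (S u v : nat) : indep S u v ->
  [/\ (0 < u)%N, (0 < v)%N & u != v].
Proof.
by rewrite /indep /off lxor_eq0 -!lt0n => /and3P[/andP[-> _] /andP[-> _] /andP[]].
Qed.

(** True iff the four signs have product -1. Three of the products uv, uV, Uv, UV have a raised
    factor and reverse their sign, which turns the required product +1 into -1. *)
Definition quad (S u v : nat) : bool :=
  positive u v (+) positive (u (+) S)%N v
  (+) (positive u (v (+) S)%N (+) positive (u (+) S)%N (v (+) S)%N).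

Lemma quad_lxorl (S u v : nat) : quad S (u (+) S)%N v = quad S u v.
Proof. by rewrite /quad lxorK; do 4!case: positive. Qed.

Lemma quadC (S u v : nat) : indep S u v -> quad S v u = quad S u v.
Proof.
move=> i00.
have i10 : indep S (u (+) S)%N v by rewrite indep_lxorl.
have i01 : indep S u (v (+) S)%N by rewrite indepC indep_lxorl indepC.
have i11 : indep S (u (+) S)%N (v (+) S)%N by rewrite indep_lxorl.
rewrite /quad; case/indep_gt0: i00 i10 i01 i11 => a b c /indep_gt0[d _ e].
move=> /indep_gt0[_ f g] /indep_gt0[_ _ h].
rewrite (positiveC a b c) (positiveC d b e) (positiveC a f g) (positiveC d f h).
by do 4!case: positive.
Qed.

(** Rotating each of the four trips gives the pairs of {v, v (+) S} x {u (+) v, u (+) v (+) S} in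
    another order, since two copies of [S] cancel. *)
Lemma quad_rot (S u v : nat) : quad S v (u (+) v)%N = quad S u v.
Proof.
rewrite /quad -(positive_rot u v) -(positive_rot (u (+) S)%N v).
rewrite -(positive_rot u (v (+) S)%N).
rewrite -(positive_rot (u (+) S)%N (v (+) S)%N).
rewrite (lxorAC u S v) -!Nat.lxor_assoc (lxorAC u S v) lxorK.
by do 4!case: positive.
Qed.

(** * Zero division as a parity condition *)

Lemma zero_divide_quad (R : realType) (N S u v : nat) :
  (0 < N)%N -> (S < generator N)%N -> (u < generator N)%N ->
  (v < generator N)%N -> indep S u v -> zero_divide R N S u v = quad S u v.
Proof.
case: N => // n _; rewrite /generator /= => lS lu lv i00.
have lu' := lxor_lt lu lS; have lv' := lxor_lt lv lS.
have luv := lxor_lt lu lv.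
have lX w : (w < 2 ^ n)%N ->
    Uindex n.+1 S w = ((w (+) S) + 2 ^ n)%N.
  by move=> lw; rewrite /Uindex /generator /= addnC lxor_hir.
have i10 : indep S (u (+) S)%N v by rewrite indep_lxorl.
have i01 : indep S u (v (+) S)%N by rewrite indepC indep_lxorl indepC.
have i11 : indep S (u (+) S)%N (v (+) S)%N by rewrite indep_lxorl.
have [u0 v0 uv] := indep_gt0 i00; have [u'0 _ u'v] := indep_gt0 i10.
have [_ v'0 uv'] := indep_gt0 i01; have [_ _ u'v'] := indep_gt0 i11.
have e2 : (2 ^ n.+1 = 2 ^ n + 2 ^ n)%N by rewrite expnS mul2n addnn.
(* uv and UV fall on one unit, uV and Uv on another. A raised factor reverses the sign, hence the
   exponent [~~ positive] for uv alone. *)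
have prodE (s t : bool) :
    ion_mul (diagonal R n.+1 S u s) (diagonal R n.+1 S v t)
    = ((-1) ^+ (~~ positive u v)
       + (-1) ^+ (s (+) t (+) positive (u (+) S)%N (v (+) S)%N)%B)
        *: ion_unit R n.+1 (u (+) v)%N
    + ((-1) ^+ (t (+) positive u (v (+) S)%N)%B
       + (-1) ^+ (s (+) positive (u (+) S)%N v)%B)
        *: ion_unit R n.+1 ((u (+) v (+) S) + 2 ^ n)%N.
  rewrite /diagonal !lX // !ion_mulDl !ion_mulDr.
  rewrite !ion_mul_unit; try lia.
  rewrite lxor_hilr // lxor_hir // lxor_hil //.
  rewrite -!Nat.lxor_assoc (lxorAC u S v) lxorK.
  rewrite !unit_sign_positive; try lia.
  rewrite positive_hilr ?u'0 ?v'0 // positive_hir ?u0 ?v'0 //.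
  rewrite (@positiveC v (_ + _)%N); try lia.
  rewrite positive_hir ?v0 ?u'0 // 1?eq_sym //.
  rewrite (positiveC u'0 v0 u'v) !negbK.
  rewrite !signr_addb !scalerDr !scalerDl !scalerA ?mulrA.
  by rewrite [X in _ + X = _]addrC addrACA.
have eqE s t :
    (ion_mul (diagonal R n.+1 S u s) (diagonal R n.+1 S v t) == 0) =
    (((~~ positive u v) != s (+) t (+) positive (u (+) S)%N (v (+) S)%N)
     && (t (+) positive u (v (+) S)%N != s (+) positive (u (+) S)%N v))%B.
  rewrite prodE ion_unit_free ?signrD_eq0 //; try lia.
  by have := lxor_lt luv lS; lia.
rewrite /quad; apply/existsP/idP => [[s /existsP[t]]|].
  rewrite eqE; move: s t; do 4!case: positive; by do 2!case.
move=> q; exists false; apply/existsP.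
exists (positive u v (+) positive (u (+) S)%N (v (+) S)%N)%B.
by rewrite eqE; move: q; do 4!case: positive.
Qed.

(** * Divisibility of cardinals from symmetries *)

Lemma card_involution (T : finType) (A : {set T}) (f : T -> T) (p : pred T) :
  involutive f -> {in A, forall x, f x \in A} ->
  {in A, forall x, p (f x) = ~~ p x} ->
  #|A| = (2 * #|[set x in A | p x]|)%N.
Proof.
move=> fK fA fp; rewrite -(cardsID [set x | p x] A) mul2n -addnn.
rewrite setIdE; congr (_ + _)%N.
rewrite -(card_imset _ (inv_inj fK)); apply: eq_card => x.
rewrite !inE; apply/imsetP/andP => [[y]|[Ax px]].
  rewrite !inE => /andP[npy Ay] ->; split; first exact: fA.
  by rewrite fp.
by exists (f x); rewrite ?fK // !inE fA // fp // px.
Qed.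

(** [A] is a union of orbits of [f], each with [n] elements. *)
Lemma dvdn_card_order (T : finType) (A : {set T}) (f : T -> T) (n : nat) :
  injective f -> {in A, forall x, f x \in A} ->
  {in A, forall x, order f x = n} -> (n %| #|A|)%N.
Proof.
move=> fI fA fn; have cl : fclosed f A.
  apply: (intro_closed (fconnect_sym fI)) => x _ /eqP<-; exact: fA.
rewrite -(@fcard_order_set _ f fI n A) ?dvdn_mull //.
by apply/subsetP => x /fn /eqP.
Qed.

(** * Counting the filled cells *)

Definition xor_ord (k : nat) (a b : 'I_(2 ^ k)) : 'I_(2 ^ k) :=
  Ordinal (lxor_lt (ltn_ord a) (ltn_ord b)).

Theorem theorem8 (R : realType) (N S : nat) (hN : (4 <= N)%N)
    (hS : (0 < S < generator N)%N) :
  (24 %| #|filled_cells R N S|)%N.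
Proof.
have [S0 lS] := andP hS.
have AE x : (x \in filled_cells R N S) = indep S x.1 x.2 && quad S x.1 x.2.
  case: x => u v; rewrite inE /= /emanation.
  rewrite /Lindex !ltn_ord /=.
  have [i|ni] := boolP (indep S u v).
    rewrite -(@zero_divide_quad R N) ?ltn_ord //; try lia.
    move: (i); rewrite /indep /off lxor_eq0 -!lt0n.
    move=> /and3P[-> -> /andP[/negPf uv /negPf uvS]] /=.
    by rewrite uv uvS; case: zero_divide.
  (* Distinct L-indices off both long diagonals would be independent of [S]. *)
  apply/negP => /and3P[Lu Lv].
  case: ifP => // /norP[uv /norP[uvS _]] _; case/negP: ni.
  by rewrite /indep /off lxor_eq0 -!lt0n Lu Lv uv.
move: AE lS; rewrite /generator; set k := N.-1 => AE lS.
pose T := ('I_(2 ^ k) * 'I_(2 ^ k))%type.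
pose s := Ordinal lS; pose A := filled_cells R N S.
pose fl (x : T) := (xor_ord x.1 s, x.2).
pose fr (x : T) := (x.1, xor_ord x.2 s).
pose sw (x : T) := (x.2, x.1).
pose ro (x : T) := (x.2, xor_ord x.1 x.2).
have xorK : involutive (fun a => xor_ord a s).
  by move=> a; apply/val_inj; rewrite /= lxorK.
(* As [S] is nonzero, exactly one member of each pair {a, a (+) S} is smaller than its partner; this
   selects one point per orbit below. *)
have lt_xor a : (a (+) S < a (+) S (+) S)%N = ~~ (a < a (+) S)%N.
  have ne : (a (+) S)%N != a by rewrite Nat.lxor_comm lxor_eqr; lia.
  by rewrite lxorK; lia.
have swA x : x \in A -> sw x \in A.
  by rewrite !AE /= => /andP[i q]; rewrite indepC i quadC.
have flA x : x \in A -> fl x \in A by rewrite !AE /= indep_lxorl quad_lxorl.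
have frA x : x \in A -> fr x \in A by move=> /swA/flA/swA.
have roA x : x \in A -> ro x \in A by rewrite !AE /= indep_rot quad_rot.
have d3 : (3 %| #|A|)%N.
  have roK : forall x, ro (ro (ro x)) = x.
    case=> u v; rewrite /ro /=; congr (_, _); apply/val_inj => /=;
      by rewrite lxorKC.
  apply: (@dvdn_card_order _ A ro) => //.
    exact: (can_inj (g := ro \o ro)).
  move=> x; rewrite AE => /andP[/indep_gt0[u0 v0 uv] _].
  apply: (@order_cycle _ ro [:: x; ro x; ro (ro x)]); rewrite ?mem_head //=.
    by rewrite !eqxx roK eqxx.
  (* The orbit is (u, v), (v, u (+) v), (u (+) v, u); any coincidence forces u = v. *)
  rewrite !inE !negb_or /ro -!pair_eqE /pair_eq /= -!val_eqE /=.
  rewrite lxorKC !(eq_sym (x.2 : nat)) (negPf uv) andbF andbT /=.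
  by apply/negP => /andP[/eqP-> /eqP e]; rewrite e eqxx in uv.
(* Three successive halvings. [fr] fixes the first index, so it respects the selection made for
   [fl]; [sw] exchanges the two selections, so it comes last. *)
have d8 : (8 %| #|A|)%N.
  have flK : involutive fl by case=> u v; rewrite /fl /= xorK.
  have frK : involutive fr by case=> u v; rewrite /fr /= xorK.
  have swK : involutive sw by case.
  rewrite (card_involution (p := fun x : T => x.1 < x.1 (+) S)%N flK flA); last first.
    by move=> x _; exact: lt_xor.
  set B := [set x in A | _].
  have frB x : x \in B -> fr x \in B.
    by rewrite [x \in B]inE [fr x \in B]inE => /andP[/frA-> ->].
  rewrite (card_involution (p := fun x : T => x.2 < x.2 (+) S)%N frK frB); last first.
    by move=> x _; exact: lt_xor.
  set C := [set x in B | _].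
  have swC x : x \in C -> sw x \in C.
    rewrite [x \in C]inE [sw x \in C]inE [x \in B]inE [sw x \in B]inE.
    by move=> /andP[/andP[/swA-> ->] ->].
  rewrite (card_involution (p := fun x : T => x.1 < x.2)%N swK swC).
    by rewrite !mulnA dvdn_mulr.
  move=> x; rewrite inE => /andP[]; rewrite inE AE.
  move=> /andP[/andP[/indep_gt0[_ _ uv] _] _] _ /=.
  by rewrite -leqNgt ltn_neqAle eq_sym uv.
by rewrite (@Gauss_dvd 8 3) // d8.
Qed.
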